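(* Let $\delta>0$, $\epsilon>0$, $a,b>0$ and let $c\in\mathbb{R}$ be a constant. Consider the one-dimensional two-subdomain Neumann-Neumann (NN) error iteration described in the context, on $\Omega_1=(-a,0)$, $\Omega_2=(0,b)$ with relaxation parameter $\theta$. Assume that the subdomains have the same size, $a=b$. Then the NN algorithm converges linearly for every $\theta$ with $0<\theta<1/2$, $\theta\neq 1/4$. Moreover, for $\theta=1/4$ it converges in two iterations.
   Context: Let $\Omega=(-a,b)$, $\Omega_1=(-a,0)$, $\Omega_2=(0,b)$, with interface $\Gamma=\{0\}$. Define the matrix differential operator $$A=\begin{bmatrix}1 & -\delta\frac{d^2}{dx^2}\\ \epsilon^2\frac{d^2}{dx^2}-c^2 & 1\end{bmatrix}.$$ The NN method is an iteration for solving a linear system $A(u,v)^T=(f_u,f_v)^T$ on $\Omega$ with homogeneous Neumann conditions on $\partial\Omega$; such a system arises at each time step of a linearized time discretization of the Cahn-Hilliard equation. By linearity its error satisfies the homogeneous iteration ($f_u=f_v=0$) below. NN error iteration: given initial interface errors $g^{[0]},h^{[0]}$ (numbers, since $\Gamma=\{0\}$), for $k=1,2,\dots$ and $j=1,2$ let $E_j^{[k]}=(u_j^{[k]},v_j^{[k]})^T$ solve (Dirichlet step) $$A E_j^{[k]}=0\ \text{in }\Omega_j,\qquad E_j^{[k]}(0)=\begin{bmatrix}g^{[k-1]}\\ h^{[k-1]}\end{bmatrix},\qquad \frac{d}{dx}E_j^{[k]}=0\ \text{on }\partial\Omega_j\cap\partial\Omega,$$ and then let $F_j^{[k]}=(\phi_j^{[k]},\psi_j^{[k]})^T$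 solve (Neumann step) $$A F_j^{[k]}=0\ \text{in }\Omega_j,\qquad \frac{d}{dx}F_j^{[k]}(0)=\frac{d}{dx}\left[E_1^{[k]}-E_2^{[k]}\right](0),\qquad \frac{d}{dx}F_j^{[k]}=0\ \text{on }\partial\Omega_j\cap\partial\Omega.$$ Here $\partial\Omega_1\cap\partial\Omega=\{-a\}$ and $\partial\Omega_2\cap\partial\Omega=\{b\}$. The interface values are updated by $$\begin{bmatrix}g^{[k]}\\ h^{[k]}\end{bmatrix}=\begin{bmatrix}g^{[k-1]}\\ h^{[k-1]}\end{bmatrix}-\theta\left[F_1^{[k]}(0)-F_2^{[k]}(0)\right],\qquad \theta\in(0,1).$$ Terminology: ''converges linearly'' means that, for arbitrary initial errors $g^{[0]},h^{[0]}$, the interface errors $g^{[k]},h^{[k]}$ tend to zero as $k\to\infty$ at a geometric rate $r^k$ with $r\in(0,1)$ independent of $g^{[0]},h^{[0]}$. ''Converges in two iterations'' means that, for arbitrary initial errors, $g^{[1]}=h^{[1]}=0$, so that the Dirichlet-step subdomain errors satisfy $E_1^{[2]}=0$ and $E_2^{[2]}=0$ (the second iteration gives the exact solution). *)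

(* Defs.v *)
From Stdlib Require Import Reals.
Open Scope R_scope.

(* A pair E = (u, v)^T of functions together with its derivative
   dE/dx = (du, dv)^T.  Only the values on the closed subdomain matter; there
   [C1_on] determines du and dv from u and v. *)
Record profile := Profile {
  pu : R -> R;
  pv : R -> R;
  pdu : R -> R;
  pdv : R -> R
}.

Definition Icc (l r : R) : R -> Prop := fun x => l <= x <= r.

(* f is C^1 up to the boundary of [l, r] with derivative f': [D_in] and
   [continue_in] are relative to the closed interval, hence one-sided at the
   end points. *)
Definition C1_on (l r : R) (f f' : R -> R) : Prop :=
  forall x, l <= x <= r ->
    D_in f f' (Icc l r) x /\ continue_in f' (Icc l r) x.

(* The matrix operator
     A = [ 1                        - delta d^2/dx^2 ]
         [ eps^2 d^2/dx^2 - c^2      1               ]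
   applied to (u, v)^T at a point where u, v take the values u0, v0 and their
   second derivatives the values u2, v2. *)
Definition A_op (delta eps c u0 v0 u2 v2 : R) : R * R :=
  (u0 - delta * v2, (eps ^ 2 * u2 - c ^ 2 * u0) + v0).

(* E is a classical solution of A E = 0 in (l, r), C^1 up to the boundary.
   Continuity of the second derivatives in (l, r) is not required separately:
   the equations express them through u and v. *)
Definition solves_A (delta eps c l r : R) (E : profile) : Prop :=
  C1_on l r (pu E) (pdu E) /\
  C1_on l r (pv E) (pdv E) /\
  forall x, l < x < r ->
    exists u2 v2 : R,
      derivable_pt_lim (pdu E) x u2 /\
      derivable_pt_lim (pdv E) x v2 /\
      A_op delta eps c (pu E x) (pv E x) u2 v2 = (0, 0).

Definition val (E : profile) (x : R) : R * R := (pu E x, pv E x).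
Definition dval (E : profile) (x : R) : R * R := (pdu E x, pdv E x).

(* In both steps the subdomain is (l, r), the interface is 0, and [o] is the
   end point of (l, r) lying on the boundary of the whole domain. *)
Definition dirichlet_step (delta eps c l r o : R) (gh : R * R) (E : profile)
  : Prop :=
  solves_A delta eps c l r E /\ val E 0 = gh /\ dval E o = (0, 0).

Definition neumann_step (delta eps c l r o : R) (jump : R * R) (F : profile)
  : Prop :=
  solves_A delta eps c l r F /\ dval F 0 = jump /\ dval F o = (0, 0).

(* The data produced by the iteration; index 0 of the subdomain errors is
   unused. *)
Record nn_run := NNRun {
  ng : nat -> R;
  nh : nat -> R;
  nE1 : nat -> profile;
  nE2 : nat -> profile;
  nF1 : nat -> profile;
  nF2 : nat -> profile
}.

Definition is_nn_run (delta eps c a b theta g0 h0 : R) (s : nn_run) : Prop :=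
  ng s 0%nat = g0 /\ nh s 0%nat = h0 /\
  forall k : nat,
    let E1 := nE1 s (S k) in
    let E2 := nE2 s (S k) in
    let F1 := nF1 s (S k) in
    let F2 := nF2 s (S k) in
    let jump := (pdu E1 0 - pdu E2 0, pdv E1 0 - pdv E2 0) in
    dirichlet_step delta eps c (- a) 0 (- a) (ng s k, nh s k) E1 /\
    dirichlet_step delta eps c 0 b b (ng s k, nh s k) E2 /\
    neumann_step delta eps c (- a) 0 (- a) jump F1 /\
    neumann_step delta eps c 0 b b jump F2 /\
    ng s (S k) = ng s k - theta * (pu F1 0 - pu F2 0) /\
    nh s (S k) = nh s k - theta * (pv F1 0 - pv F2 0).

(* In the two notions of convergence below, the first conjunct under the
   initial errors says that the iteration can be carried out, so that the
   quantification over runs is not vacuous. *)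
Definition nn_converges_linearly (delta eps c a b theta : R) : Prop :=
  exists r : R, 0 < r < 1 /\
    forall g0 h0 : R,
      (exists s, is_nn_run delta eps c a b theta g0 h0 s) /\
      forall s, is_nn_run delta eps c a b theta g0 h0 s ->
        exists C : R, forall k : nat,
          Rabs (ng s k) <= C * r ^ k /\ Rabs (nh s k) <= C * r ^ k.

Definition nn_converges_in_two_iterations (delta eps c a b theta : R) : Prop :=
  forall g0 h0 : R,
    (exists s, is_nn_run delta eps c a b theta g0 h0 s) /\
    forall s, is_nn_run delta eps c a b theta g0 h0 s ->
      ng s 1%nat = 0 /\ nh s 1%nat = 0 /\
      (forall x, - a <= x <= 0 -> val (nE1 s 2%nat) x = (0, 0)) /\
      (forall x, 0 <= x <= b -> val (nE2 s 2%nat) x = (0, 0)).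

(* Main.v *)
(* Two facts drive the proof.  First, a solution of A (u, v)^T = 0 satisfies
     (eps^2 u u' + delta v v')' = eps^2 u'^2 + delta v'^2 + c^2 u^2 >= 0,
   because the two coupling terms cancel; so a solution for which the flux
   eps^2 u u' + delta v v' vanishes at both end points is zero.  This makes both
   subdomain problems uniquely solvable.  Second, for a = b uniqueness forces
   E_2(x) = E_1(-x), hence the jump of the derivatives is 2 E_1'(0) =
   - 2 E_2'(0), and F_1 = 2 E_1, F_2 = - 2 E_2.  The update therefore multiplies
   (g, h) by 1 - 4 theta. *)

Require Import Defs.
From Stdlib Require Import Reals Lra.
Open Scope R_scope.

(** * Continuity and derivatives relative to a closed interval *)

(** If [f x0 < m], relative continuity gives [f < m] near [x0], in particular at some point of the
    open interval (p, q). The point [x0] may be an end point of [p, q], which is where the bound is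
    wanted. *)
Lemma continue_in_Icc_ge (l r p q m x0 : R) (f : R -> R) :
  l <= p -> p < q -> q <= r -> p <= x0 <= q ->
  continue_in f (Icc l r) x0 ->
  (forall x, p < x < q -> m <= f x) -> m <= f x0.
Proof.
  intros Hlp Hpq Hqr Hx0 Hc Hm.
  destruct (Rle_lt_dec m (f x0)) as [H|H]; [exact H|exfalso].
  destruct (Hc (m - f x0)) as [alp [Halp Hd]]; [lra|].
  (* The limit ignores [x0] itself, so the test point must differ from it: it is taken to the right
     of [x0] when there is room, otherwise [x0 = q] and it is taken to the left. *)
  assert (Hex : exists x, p < x < q /\ x <> x0 /\ Rabs (x - x0) < alp).
  { destruct (Rlt_le_dec x0 q) as [Hq|Hq].
    - exists (x0 + Rmin alp (q - x0) / 2).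
      assert (0 < Rmin alp (q - x0)) by (apply Rmin_pos; lra).
      pose proof (Rmin_l alp (q - x0)); pose proof (Rmin_r alp (q - x0)).
      repeat split; try lra.
      apply Rabs_def1; lra.
    - exists (x0 - Rmin alp (q - p) / 2).
      assert (0 < Rmin alp (q - p)) by (apply Rmin_pos; lra).
      pose proof (Rmin_l alp (q - p)); pose proof (Rmin_r alp (q - p)).
      repeat split; try lra.
      apply Rabs_def1; lra. }
  destruct Hex as [x [Hx [Hne Hxa]]].
  specialize (Hm x Hx).
  assert (Hlt : Rabs (f x - f x0) < m - f x0).
  { apply (Hd x). split; [|exact Hxa].
    split; [unfold Icc; lra|intro; apply Hne; symmetry; assumption]. }
  apply Rabs_def2 in Hlt. lra.
Qed.

Lemma continue_in_Icc_le (l r p q m x0 : R) (f : R -> R) :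
  l <= p -> p < q -> q <= r -> p <= x0 <= q ->
  continue_in f (Icc l r) x0 ->
  (forall x, p < x < q -> f x <= m) -> f x0 <= m.
Proof.
  intros Hlp Hpq Hqr Hx0 Hc Hm.
  assert (- m <= - f x0); [|lra].
  apply (continue_in_Icc_ge l r p q (- m) x0 (fun x => - f x)); try assumption.
  - exact (limit_Ropp f (D_x (Icc l r) x0) (f x0) x0 Hc).
  - intros x Hx. specialize (Hm x Hx). lra.
Qed.

Lemma continue_in_Icc_zero (l r x0 : R) (f : R -> R) :
  l < r -> l <= x0 <= r -> continue_in f (Icc l r) x0 ->
  (forall x, l < x < r -> f x = 0) -> f x0 = 0.
Proof.
  intros Hlr Hx0 Hc Hz. apply Rle_antisym.
  - apply (continue_in_Icc_le l r l r); try assumption; try lra.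
    intros x Hx. rewrite (Hz x Hx). lra.
  - apply (continue_in_Icc_ge l r l r); try assumption; try lra.
    intros x Hx. rewrite (Hz x Hx). lra.
Qed.

Lemma D_in_Icc_derivable_pt_lim (l r x : R) (f f' : R -> R) :
  l < x < r -> D_in f f' (Icc l r) x -> derivable_pt_lim f x (f' x).
Proof.
  intros Hx Hd e He.
  destruct (Hd e He) as [alp [Halp Ha]].
  assert (Hpos : 0 < Rmin alp (Rmin (x - l) (r - x))).
  { repeat apply Rmin_pos; lra. }
  exists (mkposreal _ Hpos). intros h Hh Hlt. simpl in Hlt.
  pose proof (Rmin_l alp (Rmin (x - l) (r - x))).
  pose proof (Rmin_r alp (Rmin (x - l) (r - x))).
  pose proof (Rmin_l (x - l) (r - x)).
  pose proof (Rmin_r (x - l) (r - x)).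
  assert (Hq : Rabs ((f (x + h) - f x) / (x + h - x) - f' x) < e).
  { apply (Ha (x + h)). simpl. unfold Rdist.
    replace (x + h - x) with h by ring.
    assert (Hh2 : Rabs h < Rmin (x - l) (r - x)) by lra.
    apply Rabs_def2 in Hh2.
    repeat split; unfold Icc; lra. }
  replace (x + h - x) with h in Hq by ring. exact Hq.
Qed.

Lemma derivable_pt_lim_zero_on (l r x d : R) (f : R -> R) :
  l < x < r -> (forall y, l < y < r -> f y = 0) ->
  derivable_pt_lim f x d -> d = 0.
Proof.
  intros Hx Hz Hd.
  apply (uniqueness_limite (fun _ => 0) x); [|apply derivable_pt_lim_const].
  exact (derivable_pt_lim_locally_ext f (fun _ => 0) x l r d Hx Hz Hd).
Qed.

(** The mean value theorem makes [f] nondecreasing on the open interval, and continuity squeezes it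
    between [f l] and [f r]. Equal end values leave only a constant. *)
Lemma nonneg_derivative_flat (l r : R) (f f' : R -> R) :
  l < r -> (forall x, l <= x <= r -> continue_in f (Icc l r) x) ->
  (forall x, l < x < r -> derivable_pt_lim f x (f' x)) ->
  (forall x, l < x < r -> 0 <= f' x) ->
  f l = f r -> forall x, l < x < r -> f' x = 0.
Proof.
  intros Hlr Hc Hd Hp Heq.
  assert (Hmono : forall x y, l < x -> x < y -> y < r -> f x <= f y).
  { intros x y Hlx Hxy Hyr.
    destruct (MVT_cor2 f f' x y Hxy) as [z [Hz Hxz]].
    - intros w Hw. apply Hd. lra.
    - assert (0 <= f' z * (y - x)); [|lra].
      apply Rmult_le_pos; [apply Hp|]; lra. }
  assert (Hz : forall x, l < x < r -> f x - f l = 0).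
  { intros x Hx.
    assert (f l <= f x).
    { apply (continue_in_Icc_le l r l x); try lra.
      - apply Hc; lra.
      - intros y Hy. apply Hmono; lra. }
    assert (f x <= f r).
    { apply (continue_in_Icc_ge l r x r); try lra.
      - apply Hc; lra.
      - intros y Hy. apply Hmono; lra. }
    lra. }
  intros x Hx.
  apply (derivable_pt_lim_zero_on l r x _ (fun y => f y - f l) Hx Hz).
  replace (f' x) with (f' x - 0) by ring.
  apply (derivable_pt_lim_minus f (fun _ => f l)).
  - apply Hd, Hx.
  - apply derivable_pt_lim_const.
Qed.

Lemma derivable_C1_on (l r : R) (f f' f'' : R -> R) :
  (forall x, derivable_pt_lim f x (f' x)) ->
  (forall x, derivable_pt_lim f' x (f'' x)) -> C1_on l r f f'.
Proof.
  assert (HD : forall g g' x, derivable_pt_lim g x (g' x) ->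
    D_in g g' (Icc l r) x).
  { intros g g' x Hg. apply derivable_pt_lim_D_in in Hg.
    refine (limit1_imp _ _ _ _ _ _ Hg).
    intros y [_ Hy]. split; [exact I|exact Hy]. }
  intros Hf Hf' x _. split.
  - apply HD, Hf.
  - apply (cont_deriv f' f''). apply HD, Hf'.
Qed.

Lemma C1_on_continue_in (l r : R) (f f' : R -> R) :
  C1_on l r f f' -> forall x, l <= x <= r -> continue_in f (Icc l r) x.
Proof. intros H x Hx. apply (cont_deriv f f'), H, Hx. Qed.

Lemma C1_on_comb (l r s t : R) (f f' g g' : R -> R) :
  C1_on l r f f' -> C1_on l r g g' ->
  C1_on l r (fun x => s * f x + t * g x) (fun x => s * f' x + t * g' x).
Proof.
  intros Hf Hg x Hx.
  destruct (Hf x Hx) as [Df Cf], (Hg x Hx) as [Dg Cg]. split.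
  - apply (Dadd _ (fun x => s * f' x) (fun x => t * g' x)
             (fun x => s * f x) (fun x => t * g x));
      apply Dmult_const; assumption.
  - apply (limit_plus (fun x => s * f' x) (fun x => t * g' x)).
    + apply (limit_mul (fun _ => s) f'); [|exact Cf].
      exact (limit_free (fun _ => s) _ x x).
    + apply (limit_mul (fun _ => t) g'); [|exact Cg].
      exact (limit_free (fun _ => t) _ x x).
Qed.

(** The map y -> -y carries punctured neighbourhoods of x in one interval isometrically to those of
    -x in the other, so the same [alp] serves in every limit. *)
Lemma C1_on_reflect (l r : R) (f f' : R -> R) :
  C1_on l r f f' ->
  C1_on (- r) (- l) (fun x => f (- x)) (fun x => - f' (- x)).
Proof.
  intros Hf x Hx.
  destruct (Hf (- x)) as [Df Cf]; [lra|].
  assert (Hrefl : forall y alp,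
    D_x (Icc (- r) (- l)) x y /\ Rabs (y - x) < alp ->
    D_x (Icc l r) (- x) (- y) /\ Rabs (- y - - x) < alp).
  { intros y alp [[[Hy1 Hy2] Hne] Hlt]. split.
    - split; [unfold Icc|]; lra.
    - replace (- y - - x) with (- (y - x)) by ring. rewrite Rabs_Ropp. exact Hlt. }
  split.
  - intros e He. destruct (Df e He) as [alp [Halp Ha]].
    exists alp. split; [exact Halp|]. intros y Hy.
    specialize (Ha (- y) (Hrefl y alp Hy)). simpl in *. unfold Rdist in *.
    destruct Hy as [[_ Hne] _].
    replace ((f (- y) - f (- x)) / (y - x) - - f' (- x))
      with (- ((f (- y) - f (- x)) / (- y - - x) - f' (- x))).
    + rewrite Rabs_Ropp. exact Ha.
    + field. lra.
  - intros e He. destruct (Cf e He) as [alp [Halp Ha]].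
    exists alp. split; [exact Halp|]. intros y Hy.
    specialize (Ha (- y) (Hrefl y alp Hy)). simpl in *. unfold Rdist in *.
    replace (- f' (- y) - - f' (- x)) with (- (f' (- y) - f' (- x))) by ring.
    rewrite Rabs_Ropp. exact Ha.
Qed.

Lemma derivable_pt_lim_affine (f : R -> R) (s o x d : R) :
  derivable_pt_lim f (s * (x - o)) d ->
  derivable_pt_lim (fun y => f (s * (y - o))) x (d * s).
Proof.
  intros H. replace (d * s) with (d * (s * (1 - 0))) by ring.
  apply (derivable_pt_lim_comp (fun y => s * (y - o)) f); [|exact H].
  apply (derivable_pt_lim_scal (fun y => y - o)).
  apply (derivable_pt_lim_minus id (fun _ => o)).
  - apply derivable_pt_lim_id.
  - apply derivable_pt_lim_const.
Qed.

Lemma derivable_pt_lim_reflect (f : R -> R) (x d : R) :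
  derivable_pt_lim f (- x) d -> derivable_pt_lim (fun y => f (- y)) x (- d).
Proof.
  intros H. replace (- d) with (d * - 1) by ring.
  apply (derivable_pt_lim_comp (fun y => - y) f); [|exact H].
  apply (derivable_pt_lim_opp id), derivable_pt_lim_id.
Qed.

Lemma derivable_pt_lim_comb (f g : R -> R) (s t x df dg : R) :
  derivable_pt_lim f x df -> derivable_pt_lim g x dg ->
  derivable_pt_lim (fun y => s * f y + t * g y) x (s * df + t * dg).
Proof.
  intros Hf Hg.
  apply (derivable_pt_lim_plus (fun y => s * f y) (fun y => t * g y));
    apply derivable_pt_lim_scal; assumption.
Qed.

(** * The solution space of A E = 0 *)

Definition profile_comb (s : R) (E : profile) (t : R) (F : profile) : profile :=
  Profile (fun x => s * pu E x + t * pu F x) (fun x => s * pv E x + t * pv F x)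
    (fun x => s * pdu E x + t * pdu F x) (fun x => s * pdv E x + t * pdv F x).

Definition profile_reflect (E : profile) : profile :=
  Profile (fun x => pu E (- x)) (fun x => pv E (- x))
    (fun x => - pdu E (- x)) (fun x => - pdv E (- x)).

Lemma A_op_eq_0 (delta eps c u0 v0 u2 v2 : R) :
  A_op delta eps c u0 v0 u2 v2 = (0, 0) ->
  u0 - delta * v2 = 0 /\ eps ^ 2 * u2 - c ^ 2 * u0 + v0 = 0.
Proof. intros H. exact (conj (f_equal fst H) (f_equal snd H)). Qed.

Lemma solves_A_comb (delta eps c l r s t : R) (E F : profile) :
  solves_A delta eps c l r E -> solves_A delta eps c l r F ->
  solves_A delta eps c l r (profile_comb s E t F).
Proof.
  intros [HEu [HEv HE]] [HFu [HFv HF]].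
  split; [|split]; try (apply C1_on_comb; assumption).
  intros x Hx.
  destruct (HE x Hx) as [u2 [v2 [Hu2 [Hv2 HA]]]].
  destruct (HF x Hx) as [y2 [z2 [Hy2 [Hz2 HB]]]].
  destruct (A_op_eq_0 _ _ _ _ _ _ _ HA) as [HA1 HA2].
  destruct (A_op_eq_0 _ _ _ _ _ _ _ HB) as [HB1 HB2].
  exists (s * u2 + t * y2), (s * v2 + t * z2).
  split; [|split]; try (apply derivable_pt_lim_comb; assumption).
  unfold A_op; cbn [profile_comb pu pv]; f_equal.
  - replace 0 with (s * (pu E x - delta * v2) + t * (pu F x - delta * z2)).
    + ring.
    + rewrite HA1, HB1. ring.
  - replace 0 with (s * (eps ^ 2 * u2 - c ^ 2 * pu E x + pv E x)
      + t * (eps ^ 2 * y2 - c ^ 2 * pu F x + pv F x)).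
    + ring.
    + rewrite HA2, HB2. ring.
Qed.

(** The operator contains only derivatives of even order, so the second derivatives at x are simply
    those of [E] at -x. *)
Lemma solves_A_reflect (delta eps c l r : R) (E : profile) :
  solves_A delta eps c l r E ->
  solves_A delta eps c (- r) (- l) (profile_reflect E).
Proof.
  intros [HEu [HEv HE]].
  split; [|split]; try (apply C1_on_reflect; assumption).
  intros x Hx.
  destruct (HE (- x)) as [u2 [v2 [Hu2 [Hv2 HA]]]]; [lra|].
  exists u2, v2.
  split; [|split; [|exact HA]].
  - rewrite <- (Ropp_involutive u2).
    apply (derivable_pt_lim_opp (fun y => pdu E (- y))).
    apply derivable_pt_lim_reflect, Hu2.
  - rewrite <- (Ropp_involutive v2).
    apply (derivable_pt_lim_opp (fun y => pdv E (- y))).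
    apply derivable_pt_lim_reflect, Hv2.
Qed.

(** * Uniqueness from the flux identity *)

Definition flux (delta eps : R) (E : profile) (x : R) : R :=
  eps ^ 2 * (pu E x * pdu E x) + delta * (pv E x * pdv E x).

(** The derivative of the flux is a sum of squares. Equal end values force it to vanish inside,
    hence u' = v' = 0 there; the equations then give u = v = 0, and continuity reaches the end
    points. *)
Lemma solves_A_unique (delta eps c l r : R) (E : profile) :
  0 < delta -> 0 < eps -> l < r -> solves_A delta eps c l r E ->
  flux delta eps E l = 0 -> flux delta eps E r = 0 ->
  forall x, l <= x <= r ->
    pu E x = 0 /\ pv E x = 0 /\ pdu E x = 0 /\ pdv E x = 0.
Proof.
  intros Hdelta Heps Hlr [HEu [HEv HE]] Hl Hr.
  assert (Heps2 : 0 < eps ^ 2) by (apply pow_lt, Heps).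
  assert (Hcu := C1_on_continue_in _ _ _ _ HEu).
  assert (Hcv := C1_on_continue_in _ _ _ _ HEv).
  assert (Hcont : forall x, l <= x <= r ->
    continue_in (flux delta eps E) (Icc l r) x).
  { intros x Hx.
    apply (limit_plus (fun x => eps ^ 2 * (pu E x * pdu E x))
             (fun x => delta * (pv E x * pdv E x))).
    - apply (limit_mul (fun _ => eps ^ 2) (fun x => pu E x * pdu E x)).
      + exact (limit_free (fun _ => eps ^ 2) _ x x).
      + apply limit_mul; [apply Hcu, Hx|apply HEu, Hx].
    - apply (limit_mul (fun _ => delta) (fun x => pv E x * pdv E x)).
      + exact (limit_free (fun _ => delta) _ x x).
      + apply limit_mul; [apply Hcv, Hx|apply HEv, Hx]. }
  set (dissip := fun x =>
    eps ^ 2 * (pdu E x * pdu E x) + delta * (pdv E x * pdv E x)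
    + (c * pu E x) * (c * pu E x)).
  assert (Hder : forall x, l < x < r ->
    derivable_pt_lim (flux delta eps E) x (dissip x)).
  { intros x Hx.
    destruct (HE x Hx) as [u2 [v2 [Hu2 [Hv2 HA]]]].
    destruct (A_op_eq_0 _ _ _ _ _ _ _ HA) as [HA1 HA2].
    assert (Hu : derivable_pt_lim (pu E) x (pdu E x)).
    { apply (D_in_Icc_derivable_pt_lim l r); [exact Hx|apply HEu; lra]. }
    assert (Hv : derivable_pt_lim (pv E) x (pdv E x)).
    { apply (D_in_Icc_derivable_pt_lim l r); [exact Hx|apply HEv; lra]. }
    replace (dissip x) with
      (eps ^ 2 * (pdu E x * pdu E x + pu E x * u2)
       + delta * (pdv E x * pdv E x + pv E x * v2)).
    - apply (derivable_pt_lim_comb (fun x => pu E x * pdu E x)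
               (fun x => pv E x * pdv E x)).
      + exact (derivable_pt_lim_mult _ _ _ _ _ Hu Hu2).
      + exact (derivable_pt_lim_mult _ _ _ _ _ Hv Hv2).
    - unfold dissip.
      (* Both summands are rewritten to display the left-hand sides of the two equations; what
         remains are the squares and the coupling terms -uv and +uv. *)
      replace (eps ^ 2 * (pdu E x * pdu E x + pu E x * u2)) with
        (eps ^ 2 * (pdu E x * pdu E x)
         + pu E x * (eps ^ 2 * u2 - c ^ 2 * pu E x + pv E x)
         + (c * pu E x) * (c * pu E x) - pu E x * pv E x) by ring.
      replace (delta * (pdv E x * pdv E x + pv E x * v2)) with
        (delta * (pdv E x * pdv E x) - pv E x * (pu E x - delta * v2)
         + pu E x * pv E x) by ring.
      rewrite HA1, HA2. ring. }
  assert (Hnn : forall x, 0 <= eps ^ 2 * (pdu E x * pdu E x) /\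
    0 <= delta * (pdv E x * pdv E x) /\ 0 <= (c * pu E x) * (c * pu E x)).
  { intros x. repeat split; try (apply Rmult_le_pos; [lra|]); apply Rle_0_sqr. }
  assert (Hflat : forall x, l < x < r -> dissip x = 0).
  { apply (nonneg_derivative_flat l r (flux delta eps E)); try assumption; [|congruence].
    intros x _. unfold dissip. destruct (Hnn x) as [? [? ?]]. lra. }
  assert (Hdu : forall x, l < x < r -> pdu E x = 0).
  { intros x Hx. apply Rsqr_0_uniq. unfold Rsqr.
    apply (Rmult_eq_reg_l (eps ^ 2)); [|lra].
    specialize (Hflat x Hx). unfold dissip in Hflat.
    destruct (Hnn x) as [? [? ?]]. lra. }
  assert (Hdv : forall x, l < x < r -> pdv E x = 0).
  { intros x Hx. apply Rsqr_0_uniq. unfold Rsqr.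
    apply (Rmult_eq_reg_l delta); [|lra].
    specialize (Hflat x Hx). unfold dissip in Hflat.
    destruct (Hnn x) as [? [? ?]]. lra. }
  (* Since c may be 0, the term c^2 u^2 does not yield u = 0. Instead u'' and v'' vanish with u' and
     v': the first equation gives u = 0, the second then v = 0. *)
  assert (Huv : forall x, l < x < r -> pu E x = 0 /\ pv E x = 0).
  { intros x Hx.
    destruct (HE x Hx) as [u2 [v2 [Hu2 [Hv2 HA]]]].
    apply (derivable_pt_lim_zero_on l r x _ _ Hx Hdu) in Hu2.
    apply (derivable_pt_lim_zero_on l r x _ _ Hx Hdv) in Hv2.
    destruct (A_op_eq_0 _ _ _ _ _ _ _ HA) as [HA1 HA2]. subst u2 v2.
    assert (Hu0 : pu E x = 0) by lra. rewrite Hu0 in HA2. lra. }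
  intros x Hx.
  repeat split; apply (continue_in_Icc_zero l r); try assumption.
  - apply Hcu, Hx.
  - intros y Hy. apply Huv, Hy.
  - apply Hcv, Hx.
  - intros y Hy. apply Huv, Hy.
  - apply HEu, Hx.
  - apply HEv, Hx.
Qed.

(** * Explicit even solutions *)

(* The pair cosh (sqrt d (x - o)), sinh (sqrt d (x - o)) / sqrt d, which stays
   real for d < 0 and has a limit for d = 0. *)
Lemma exists_cosh_sinh (d o : R) :
  exists C S : R -> R, C o = 1 /\ S o = 0 /\
    (forall x, derivable_pt_lim C x (d * S x)) /\
    (forall x, derivable_pt_lim S x (C x)).
Proof.
  assert (Hs : forall s f x y, s <> 0 -> derivable_pt_lim f (s * (x - o)) y ->
    derivable_pt_lim (fun x => / s * f (s * (x - o))) x y).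
  { intros s f x y Hs0 Hf. replace y with (/ s * (y * s)) by (field; exact Hs0).
    apply (derivable_pt_lim_scal (fun x => f (s * (x - o)))).
    apply derivable_pt_lim_affine, Hf. }
  (* The three cases are trigonometric with s^2 = -d, polynomial, and hyperbolic with s^2 = d. *)
  destruct (Rtotal_order d 0) as [Hd|[Hd|Hd]].
  - assert (Hp : 0 < sqrt (- d)) by (apply sqrt_lt_R0; lra).
    assert (Hsq : sqrt (- d) * sqrt (- d) = - d) by (apply sqrt_sqrt; lra).
    revert Hp Hsq. generalize (sqrt (- d)). intros s Hp Hsq.
    exists (fun x => cos (s * (x - o))), (fun x => / s * sin (s * (x - o))).
    replace (s * (o - o)) with 0 by ring. rewrite cos_0, sin_0.
    split; [reflexivity|split; [ring|split]]; intros x.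
    + replace (d * (/ s * sin (s * (x - o)))) with (- sin (s * (x - o)) * s).
      * apply derivable_pt_lim_affine, derivable_pt_lim_cos.
      * replace d with (- (s * s)) by lra. field. lra.
    + apply Hs; [lra|apply derivable_pt_lim_sin].
  - subst d. exists (fun _ => 1), (fun x => x - o).
    split; [reflexivity|split; [ring|split]]; intros x.
    + replace (0 * (x - o)) with 0 by ring. apply derivable_pt_lim_const.
    + replace 1 with (1 - 0) by ring.
      apply (derivable_pt_lim_minus id (fun _ => o)).
      * apply derivable_pt_lim_id.
      * apply derivable_pt_lim_const.
  - assert (Hp : 0 < sqrt d) by (apply sqrt_lt_R0; lra).
    assert (Hsq : sqrt d * sqrt d = d) by (apply sqrt_sqrt; lra).
    revert Hp Hsq. generalize (sqrt d). intros s Hp Hsq.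
    exists (fun x => cosh (s * (x - o))), (fun x => / s * sinh (s * (x - o))).
    replace (s * (o - o)) with 0 by ring. rewrite cosh_0, sinh_0.
    split; [reflexivity|split; [ring|split]]; intros x.
    + replace (d * (/ s * sinh (s * (x - o)))) with (sinh (s * (x - o)) * s).
      * apply derivable_pt_lim_affine, derivable_pt_lim_cosh.
      * rewrite <- Hsq. field. lra.
    + apply Hs; [lra|apply derivable_pt_lim_sinh].
Qed.

(* Eliminating u gives v'''' - 2 al v'' + be^2 v = 0 with 2 al = c^2 / eps^2 and
   be^2 = 1 / (eps^2 delta).  Its characteristic equation reads
   (z^2 + be)^2 = 4 d1 z^2 with d1 = (al + be) / 2 > 0, so that the roots are
   +- sqrt d1 +- sqrt d2 with d2 = (al - be) / 2 of either sign.
   Products of cosh-like and sinh-like functions for d1 and d2 span the even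
   solutions about o, uniformly in the sign of d2; s and t are the coordinates
   in that span, and (s, t) -> (al s + 2 t, 2 d1 d2 s + al t) is d^2/dx^2. *)
Lemma exists_even_solutions (delta eps c o : R) :
  0 < delta -> 0 < eps ->
  exists P Q : profile,
    (forall l r, solves_A delta eps c l r P /\ solves_A delta eps c l r Q) /\
    dval P o = (0, 0) /\ dval Q o = (0, 0) /\
    pv P o = 1 /\ pv Q o = 0 /\ pu Q o <> 0.
Proof.
  intros Hdelta Heps.
  set (al := c ^ 2 / (2 * eps ^ 2)).
  set (be := / (eps * sqrt delta)).
  assert (Hsd : 0 < sqrt delta) by (apply sqrt_lt_R0, Hdelta).
  assert (Hal : 2 * (eps ^ 2 * al) = c ^ 2).
  { unfold al. field. lra. }
  assert (Hbe : delta * eps ^ 2 * be ^ 2 = 1).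
  { transitivity (sqrt delta * sqrt delta * eps ^ 2 * be ^ 2).
    - rewrite sqrt_sqrt by lra. reflexivity.
    - unfold be. field. lra. }
  set (d1 := (al + be) / 2). set (d2 := (al - be) / 2).
  assert (Hsum : d1 + d2 = al) by (unfold d1, d2; field).
  assert (Hprod : 4 * (d1 * d2) = al ^ 2 - be ^ 2) by (unfold d1, d2; field).
  (* From here on the constants enter only through [Hal], [Hbe], [Hsum] and [Hprod]. *)
  clearbody al be d1 d2.
  destruct (exists_cosh_sinh d1 o) as [C1 [S1 [HC1 [HS1 [DC1 DS1]]]]].
  destruct (exists_cosh_sinh d2 o) as [C2 [S2 [HC2 [HS2 [DC2 DS2]]]]].
  set (w := fun s t x => s * (C1 x * C2 x) + t * (S1 x * S2 x)).
  set (dw := fun s t x =>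
    s * (d1 * S1 x * C2 x + C1 x * (d2 * S2 x))
    + t * (C1 x * S2 x + S1 x * C2 x)).
  set (n1 := fun s t => al * s + 2 * t).
  set (n2 := fun s t => 2 * (d1 * d2) * s + al * t).
  assert (Hw : forall s t x, derivable_pt_lim (w s t) x (dw s t x)).
  { intros s t x.
    apply (derivable_pt_lim_comb (fun x => C1 x * C2 x) (fun x => S1 x * S2 x)).
    - exact (derivable_pt_lim_mult _ _ _ _ _ (DC1 x) (DC2 x)).
    - exact (derivable_pt_lim_mult _ _ _ _ _ (DS1 x) (DS2 x)). }
  assert (Hdw : forall s t x,
    derivable_pt_lim (dw s t) x (w (n1 s t) (n2 s t) x)).
  { intros s t x.
    assert (H1 : derivable_pt_lim (fun x => S1 x * C2 x) x
      (C1 x * C2 x + S1 x * (d2 * S2 x))).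
    { exact (derivable_pt_lim_mult _ _ _ _ _ (DS1 x) (DC2 x)). }
    assert (H2 : derivable_pt_lim (fun x => C1 x * S2 x) x
      (d1 * S1 x * S2 x + C1 x * C2 x)).
    { exact (derivable_pt_lim_mult _ _ _ _ _ (DC1 x) (DS2 x)). }
    apply (derivable_pt_lim_ext
      (fun x => (s * d1 + t) * (S1 x * C2 x) + (s * d2 + t) * (C1 x * S2 x))).
    - intros y. unfold dw. ring.
    - replace (w (n1 s t) (n2 s t) x) with
        ((s * d1 + t) * (C1 x * C2 x + S1 x * (d2 * S2 x))
         + (s * d2 + t) * (d1 * S1 x * S2 x + C1 x * C2 x)).
      + apply derivable_pt_lim_comb; assumption.
      + unfold w, n1, n2. rewrite <- Hsum. ring. }
  (* The first equation dictates u = delta v'', so v = [w s t] determines the whole profile. *)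
  set (sol := fun s t => Profile
    (fun x => delta * w (n1 s t) (n2 s t) x) (w s t)
    (fun x => delta * dw (n1 s t) (n2 s t) x) (dw s t)).
  assert (Hsol : forall s t l r, solves_A delta eps c l r (sol s t)).
  { intros s t l r. split; [|split].
    - apply (derivable_C1_on l r _ _ (fun x =>
        delta * w (n1 (n1 s t) (n2 s t)) (n2 (n1 s t) (n2 s t)) x));
        intros x; apply derivable_pt_lim_scal; [apply Hw|apply Hdw].
    - apply (derivable_C1_on l r _ _ (w (n1 s t) (n2 s t))); [apply Hw|apply Hdw].
    - intros x _.
      exists (delta * w (n1 (n1 s t) (n2 s t)) (n2 (n1 s t) (n2 s t)) x),
        (w (n1 s t) (n2 s t) x).
      split; [apply derivable_pt_lim_scal, Hdw|split; [apply Hdw|]].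
      unfold A_op; cbn [sol pu pv]; f_equal; [ring|].
      (* Cayley-Hamilton for the matrix of second derivation. *)
      assert (HCH : w (n1 (n1 s t) (n2 s t)) (n2 (n1 s t) (n2 s t)) x
        = 2 * al * w (n1 s t) (n2 s t) x - be ^ 2 * w s t x).
      { replace (be ^ 2) with (al ^ 2 - 4 * (d1 * d2)) by lra.
        unfold w, n1, n2. ring. }
      rewrite HCH, <- Hal.
      (* The isolated v of the second equation receives the factor delta eps^2 be^2 = 1, so that it
         cancels the be^2 term produced by [HCH]. *)
      replace (w s t x) with (delta * eps ^ 2 * be ^ 2 * w s t x) at 2
        by (rewrite Hbe; ring).
      ring. }
  (* Here v is C1 C2 or S1 S2. At [o] the second choice has v = 0 and u = 2 delta, which makes the
     two solutions independent. *)
  exists (sol 1 0), (sol 0 1).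
  split; [auto|].
  unfold dval, sol, w, dw, n1, n2; cbn [pu pv pdu pdv].
  rewrite HC1, HC2, HS1, HS2.
  split; [f_equal; ring|].
  split; [f_equal; ring|].
  split; [ring|]. split; [ring|].
  replace (delta * _) with (2 * delta) by ring. lra.
Qed.

Lemma flux_zero_dval (delta eps : R) (E : profile) (x : R) :
  dval E x = (0, 0) -> flux delta eps E x = 0.
Proof. unfold dval, flux. intros H. injection H as H1 H2. rewrite H1, H2. ring. Qed.

Lemma flux_zero_val (delta eps : R) (E : profile) (x : R) :
  val E x = (0, 0) -> flux delta eps E x = 0.
Proof. unfold val, flux. intros H. injection H as H1 H2. rewrite H1, H2. ring. Qed.

(** * The iteration *)

Lemma dirichlet_step_comb (delta eps c l r o s t g h g' h' : R)
  (E F : profile) :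
  dirichlet_step delta eps c l r o (g, h) E ->
  dirichlet_step delta eps c l r o (g', h') F ->
  dirichlet_step delta eps c l r o (s * g + t * g', s * h + t * h')
    (profile_comb s E t F).
Proof.
  intros [HE [HE0 HEo]] [HF [HF0 HFo]].
  split; [apply solves_A_comb; assumption|].
  unfold val, dval in *; cbn [profile_comb pu pv pdu pdv].
  injection HE0 as <- <-. injection HF0 as <- <-.
  injection HEo as HEo1 HEo2. injection HFo as HFo1 HFo2.
  rewrite HEo1, HEo2, HFo1, HFo2.
  split; f_equal; ring.
Qed.

Lemma neumann_step_comb (delta eps c l r o s t g h g' h' : R)
  (E F : profile) :
  neumann_step delta eps c l r o (g, h) E ->
  neumann_step delta eps c l r o (g', h') F ->
  neumann_step delta eps c l r o (s * g + t * g', s * h + t * h')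
    (profile_comb s E t F).
Proof.
  intros [HE [HE0 HEo]] [HF [HF0 HFo]].
  split; [apply solves_A_comb; assumption|].
  unfold dval in *; cbn [profile_comb pu pv pdu pdv].
  injection HE0 as <- <-. injection HF0 as <- <-.
  injection HEo as HEo1 HEo2. injection HFo as HFo1 HFo2.
  rewrite HEo1, HEo2, HFo1, HFo2.
  split; f_equal; ring.
Qed.

Lemma dirichlet_step_reflect (delta eps c a : R) (gh : R * R) (E : profile) :
  dirichlet_step delta eps c (- a) 0 (- a) gh E ->
  dirichlet_step delta eps c 0 a a gh (profile_reflect E).
Proof.
  intros [HE [HE0 HEo]]. split; [|split].
  - apply solves_A_reflect in HE.
    rewrite Ropp_0, Ropp_involutive in HE. exact HE.
  - unfold val in *; cbn [profile_reflect pu pv]. rewrite Ropp_0. exact HE0.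
  - unfold dval in *; cbn [profile_reflect pdu pdv].
    injection HEo as -> ->. f_equal; ring.
Qed.

(** This lets E_j be combined linearly with F_j, which solves a Neumann problem. *)
Lemma dirichlet_neumann_step (delta eps c l r o : R) (gh : R * R)
  (E : profile) :
  dirichlet_step delta eps c l r o gh E ->
  neumann_step delta eps c l r o (pdu E 0, pdv E 0) E.
Proof. intros [HE [_ HEo]]. split; [exact HE|split; [reflexivity|exact HEo]]. Qed.

(** Either the values or the derivatives vanish at each end point, and so does the flux. The
    disjunction covers the right and the left subdomain. *)
Lemma dirichlet_step_zero (delta eps c l r o : R) (E : profile) :
  0 < delta -> 0 < eps -> l < r -> (l = 0 /\ o = r \/ l = o /\ r = 0) ->
  dirichlet_step delta eps c l r o (0, 0) E ->
  forall x, l <= x <= r ->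
    pu E x = 0 /\ pv E x = 0 /\ pdu E x = 0 /\ pdv E x = 0.
Proof.
  intros Hdelta Heps Hlr Hlro [HE [HE0 HEo]].
  apply (flux_zero_val delta eps) in HE0. apply (flux_zero_dval delta eps) in HEo.
  apply (solves_A_unique delta eps c); try assumption;
    destruct Hlro as [[-> ->]|[-> ->]]; assumption.
Qed.

(** The flux again vanishes at both ends. No constant mode survives: a constant solution has u =
    delta v'' = 0 and then v = 0. *)
Lemma neumann_step_zero (delta eps c l r o : R) (E : profile) :
  0 < delta -> 0 < eps -> l < r -> (l = 0 /\ o = r \/ l = o /\ r = 0) ->
  neumann_step delta eps c l r o (0, 0) E ->
  forall x, l <= x <= r ->
    pu E x = 0 /\ pv E x = 0 /\ pdu E x = 0 /\ pdv E x = 0.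
Proof.
  intros Hdelta Heps Hlr Hlro [HE [HE0 HEo]].
  apply (flux_zero_dval delta eps) in HE0, HEo.
  apply (solves_A_unique delta eps c); try assumption;
    destruct Hlro as [[-> ->]|[-> ->]]; assumption.
Qed.

(* The coefficients of the even solutions about -a solve a 2 x 2 linear system
   that is injective by uniqueness, hence invertible. *)
Lemma exists_dirichlet_step (delta eps c a : R) :
  0 < delta -> 0 < eps -> 0 < a ->
  exists D : R -> R -> profile, forall g h,
    dirichlet_step delta eps c (- a) 0 (- a) (g, h) (D g h).
Proof.
  intros Hdelta Heps Ha.
  destruct (exists_even_solutions delta eps c (- a) Hdelta Heps)
    as [P [Q [HPQ [HdP [HdQ [HP [HQ HuQ]]]]]]].
  destruct (HPQ (- a) 0) as [HsP HsQ].
  assert (HDP : dirichlet_step delta eps c (- a) 0 (- a) (pu P 0, pv P 0) P)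
    by (split; [exact HsP|split; [reflexivity|exact HdP]]).
  assert (HDQ : dirichlet_step delta eps c (- a) 0 (- a) (pu Q 0, pv Q 0) Q)
    by (split; [exact HsQ|split; [reflexivity|exact HdQ]]).
  pose proof (fun s t =>
    dirichlet_step_comb _ _ _ _ _ _ s t _ _ _ _ _ _ HDP HDQ) as Hcomb.
  (* A combination with zero interface values vanishes identically; at -a its v equals s, and then
     its u equals t times a nonzero number. *)
  assert (Hinj : forall s t, s * pu P 0 + t * pu Q 0 = 0 ->
    s * pv P 0 + t * pv Q 0 = 0 -> s = 0 /\ t = 0).
  { intros s t Hu Hv. specialize (Hcomb s t). rewrite Hu, Hv in Hcomb.
    apply dirichlet_step_zero with (x := - a) in Hcomb;
      [|assumption|assumption|lra|right; split; reflexivity|lra].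
    cbn [profile_comb pu pv] in Hcomb. destruct Hcomb as [Hcu [Hcv _]].
    rewrite HP, HQ in Hcv. assert (Hs : s = 0) by lra. split; [exact Hs|].
    rewrite Hs in Hcu.
    assert (Htu : t * pu Q (- a) = 0) by lra.
    destruct (Rmult_integral _ _ Htu); [assumption|contradiction]. }
  set (det := pu P 0 * pv Q 0 - pu Q 0 * pv P 0).
  assert (Hdet : det <> 0).
  (* If the determinant were 0, (vQ, -vP) and (uQ, -uP) would lie in the kernel, so all four entries
     would vanish; then (1, 0) would lie in the kernel too. *)
  { intros Hdet. unfold det in Hdet.
    destruct (Hinj (pv Q 0) (- pv P 0)) as [HvQ HvP]; [lra|ring|].
    destruct (Hinj (pu Q 0) (- pu P 0)) as [HuQ0 HuP]; [ring|lra|].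
    destruct (Hinj 1 0) as [H1 _]; nra. }
  (* The coefficients come from Cramer's rule. *)
  exists (fun g h => profile_comb ((g * pv Q 0 - h * pu Q 0) / det) P
    ((h * pu P 0 - g * pv P 0) / det) Q).
  intros g h.
  specialize (Hcomb ((g * pv Q 0 - h * pu Q 0) / det)
    ((h * pu P 0 - g * pv P 0) / det)).
  replace (g, h) with
    ((g * pv Q 0 - h * pu Q 0) / det * pu P 0
     + (h * pu P 0 - g * pv P 0) / det * pu Q 0,
     (g * pv Q 0 - h * pu Q 0) / det * pv P 0
     + (h * pu P 0 - g * pv P 0) / det * pv Q 0).
  - exact Hcomb.
  - f_equal; unfold det in *; field; exact Hdet.
Qed.

(** * Existence of runs and the contraction factor *)

Lemma exists_nn_run (delta eps c a theta g0 h0 : R) :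
  0 < delta -> 0 < eps -> 0 < a ->
  exists s, is_nn_run delta eps c a a theta g0 h0 s.
Proof.
  intros Hdelta Heps Ha.
  destruct (exists_dirichlet_step delta eps c a Hdelta Heps Ha) as [D HD].
  set (g := fun k : nat => (1 - 4 * theta) ^ k * g0).
  set (h := fun k : nat => (1 - 4 * theta) ^ k * h0).
  (* Iteration k starts from the interface values of index k - 1; at index 0 the value is
     arbitrary. *)
  set (E1 := fun k : nat => D (g (pred k)) (h (pred k))).
  set (E2 := fun k => profile_reflect (E1 k)).
  (* The multiples 2 E_1 and -2 E_2 are written as combinations with a zero second coefficient, to
     fit [neumann_step_comb]. *)
  exists (NNRun g h E1 E2 (fun k => profile_comb 2 (E1 k) 0 (E1 k))
    (fun k => profile_comb (- 2) (E2 k) 0 (E2 k))).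
  split; [unfold g; cbn; ring|split; [unfold h; cbn; ring|]].
  intros k. cbv zeta. cbn [ng nh nE1 nE2 nF1 nF2].
  assert (HE1 : dirichlet_step delta eps c (- a) 0 (- a) (g k, h k) (E1 (S k)))
    by apply HD.
  assert (HE2 : dirichlet_step delta eps c 0 a a (g k, h k) (E2 (S k)))
    by apply dirichlet_step_reflect, HE1.
  split; [exact HE1|split; [exact HE2|]].
  assert (HN1 := dirichlet_neumann_step _ _ _ _ _ _ _ _ HE1).
  assert (HN2 := dirichlet_neumann_step _ _ _ _ _ _ _ _ HE2).
  assert (Hj : pdu (E2 (S k)) 0 = - pdu (E1 (S k)) 0 /\
    pdv (E2 (S k)) 0 = - pdv (E1 (S k)) 0).
  { cbn [E2 profile_reflect pdu pdv]. rewrite Ropp_0. split; reflexivity. }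
  clearbody E2 E1.
  destruct Hj as [Hju Hjv]. rewrite Hju, Hjv in HN2 |- *.
  destruct HE1 as [_ [HE1 _]]. destruct HE2 as [_ [HE2 _]].
  unfold val in HE1, HE2.
  injection HE1 as Hu1 Hv1. injection HE2 as Hu2 Hv2.
  cbn [profile_comb pu pv]. rewrite Hu1, Hu2, Hv1, Hv2.
  split; [|split; [|split; [unfold g; cbn [pow]; ring|unfold h; cbn [pow]; ring]]].
  - replace (pdu (E1 (S k)) 0 - - pdu (E1 (S k)) 0)
      with (2 * pdu (E1 (S k)) 0 + 0 * pdu (E1 (S k)) 0) by ring.
    replace (pdv (E1 (S k)) 0 - - pdv (E1 (S k)) 0)
      with (2 * pdv (E1 (S k)) 0 + 0 * pdv (E1 (S k)) 0) by ring.
    apply neumann_step_comb; assumption.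
  - replace (pdu (E1 (S k)) 0 - - pdu (E1 (S k)) 0)
      with (- 2 * - pdu (E1 (S k)) 0 + 0 * - pdu (E1 (S k)) 0) by ring.
    replace (pdv (E1 (S k)) 0 - - pdv (E1 (S k)) 0)
      with (- 2 * - pdv (E1 (S k)) 0 + 0 * - pdv (E1 (S k)) 0) by ring.
    apply neumann_step_comb; assumption.
Qed.

(** For an arbitrary run, uniqueness is applied to three profiles with zero data: E_2 minus the
    reflected E_1, F_1 - 2 E_1 and F_2 + 2 E_2. *)
Lemma nn_run_contraction (delta eps c a theta g0 h0 : R) (s : nn_run) :
  0 < delta -> 0 < eps -> 0 < a ->
  is_nn_run delta eps c a a theta g0 h0 s ->
  forall k, ng s (S k) = (1 - 4 * theta) * ng s k /\
    nh s (S k) = (1 - 4 * theta) * nh s k.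
Proof.
  intros Hdelta Heps Ha [_ [_ Hs]] k.
  specialize (Hs k). cbv zeta in Hs.
  destruct Hs as [HE1 [HE2 [HF1 [HF2 [-> ->]]]]].
  revert HE1 HE2 HF1 HF2.
  generalize (nE1 s (S k)) (nE2 s (S k)) (nF1 s (S k)) (nF2 s (S k))
    (ng s k) (nh s k).
  intros E1 E2 F1 F2 g h HE1 HE2 HF1 HF2.
  assert (HN1 := dirichlet_neumann_step _ _ _ _ _ _ _ _ HE1).
  assert (HN2 := dirichlet_neumann_step _ _ _ _ _ _ _ _ HE2).
  assert (Hsym := dirichlet_step_comb _ _ _ _ _ _ 1 (- 1) _ _ _ _ _ _ HE2
    (dirichlet_step_reflect _ _ _ _ _ _ HE1)).
  replace (1 * g + - 1 * g) with 0 in Hsym by ring.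
  replace (1 * h + - 1 * h) with 0 in Hsym by ring.
  apply dirichlet_step_zero with (x := 0) in Hsym;
    [|assumption|assumption|lra|left; split; reflexivity|lra].
  cbn [profile_comb profile_reflect pu pv pdu pdv] in Hsym.
  rewrite Ropp_0 in Hsym. destruct Hsym as [_ [_ [Hju Hjv]]].
  (* By [Hju] and [Hjv] the jump is 2 E_1'(0), so F_1 - 2 E_1 has zero Neumann data. *)
  assert (HFE1 := neumann_step_comb _ _ _ _ _ _ 1 (- 2) _ _ _ _ _ _ HF1 HN1).
  replace (1 * (pdu E1 0 - pdu E2 0) + - 2 * pdu E1 0) with 0 in HFE1 by lra.
  replace (1 * (pdv E1 0 - pdv E2 0) + - 2 * pdv E1 0) with 0 in HFE1 by lra.
  apply neumann_step_zero with (x := 0) in HFE1;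
    [|assumption|assumption|lra|right; split; reflexivity|lra].
  assert (HFE2 := neumann_step_comb _ _ _ _ _ _ 1 2 _ _ _ _ _ _ HF2 HN2).
  replace (1 * (pdu E1 0 - pdu E2 0) + 2 * pdu E2 0) with 0 in HFE2 by lra.
  replace (1 * (pdv E1 0 - pdv E2 0) + 2 * pdv E2 0) with 0 in HFE2 by lra.
  apply neumann_step_zero with (x := 0) in HFE2;
    [|assumption|assumption|lra|left; split; reflexivity|lra].
  cbn [profile_comb pu pv] in HFE1, HFE2.
  destruct HFE1 as [Hu1 [Hv1 _]]. destruct HFE2 as [Hu2 [Hv2 _]].
  destruct HE1 as [_ [HE1 _]]. destruct HE2 as [_ [HE2 _]].
  unfold val in HE1, HE2.
  injection HE1 as HEu1 HEv1. injection HE2 as HEu2 HEv2.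
  rewrite HEu1 in Hu1. rewrite HEu2 in Hu2.
  rewrite HEv1 in Hv1. rewrite HEv2 in Hv2.
  (* Hence F_1(0) - F_2(0) = 4 (g, h). *)
  replace (pu F1 0) with (2 * g) by lra.
  replace (pu F2 0) with (- 2 * g) by lra.
  replace (pv F1 0) with (2 * h) by lra.
  replace (pv F2 0) with (- 2 * h) by lra.
  split; ring.
Qed.

Theorem theorem1 :
  forall delta eps a b c : R,
    0 < delta -> 0 < eps -> 0 < a -> 0 < b -> a = b ->
    (forall theta : R, 0 < theta < 1 / 2 -> theta <> 1 / 4 ->
       nn_converges_linearly delta eps c a b theta) /\
    nn_converges_in_two_iterations delta eps c a b (1 / 4).
Proof.
  intros delta eps a b c Hdelta Heps Ha _ <-. split.
  - intros theta Htheta Hne.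
    (* The rate is positive because theta is not 1/4, and below 1 because 0 < theta < 1/2. *)
    exists (Rabs (1 - 4 * theta)). split.
    + split; [apply Rabs_pos_lt; lra|apply Rabs_def1; lra].
    + intros g0 h0. split; [apply exists_nn_run; assumption|].
      intros s Hs. exists (Rabs g0 + Rabs h0).
      assert (Hk := nn_run_contraction _ _ _ _ _ _ _ _ Hdelta Heps Ha Hs).
      destruct Hs as [Hg0 [Hh0 _]].
      pose proof (Rabs_pos g0). pose proof (Rabs_pos h0).
      pose proof (Rabs_pos (1 - 4 * theta)).
      induction k as [|k [IHg IHh]].
      * rewrite Hg0, Hh0. cbn [pow]. lra.
      * destruct (Hk k) as [-> ->]. rewrite !Rabs_mult. cbn [pow].
        split; nra.
  - intros g0 h0. split; [apply exists_nn_run; assumption|].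
    intros s Hs.
    destruct (nn_run_contraction _ _ _ _ _ _ _ _ Hdelta Heps Ha Hs 0) as [Hg Hh].
    assert (Hg1 : ng s 1%nat = 0) by (rewrite Hg; field).
    assert (Hh1 : nh s 1%nat = 0) by (rewrite Hh; field).
    (* Index 1 selects the second iteration, whose Dirichlet data are now zero. *)
    destruct Hs as [_ [_ Hs]]. specialize (Hs 1%nat). cbv zeta in Hs.
    rewrite Hg1, Hh1 in Hs. destruct Hs as [HE1 [HE2 _]].
    split; [exact Hg1|]. split; [exact Hh1|].
    split; intros x Hx; unfold val.
    + apply dirichlet_step_zero with (x := x) in HE1;
        [|assumption|assumption|lra|right; split; reflexivity|lra].
      destruct HE1 as [-> [-> _]]. reflexivity.
    + apply dirichlet_step_zero with (x := x) in HE2;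
        [|assumption|assumption|lra|left; split; reflexivity|lra].
      destruct HE2 as [-> [-> _]]. reflexivity.
Qed.
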